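(* Let $k$ be a positive integer, let $f\in B_{2\pi}$ be an even band-limited function, and let $\chi_k:\mathbb{Z}\to\mathbb{C}$ be a $k$-periodic odd sequence, i.e. $\chi_k(n+k)=\chi_k(n)$ and $\chi_k(-n)=-\chi_k(n)$ for all $n\in\mathbb{Z}$. Then \[ \sum_{n=1}^\infty\frac{\chi_k(n)}{n}f(n/k)=\sum_{n=1}^\infty\frac{\chi_k(n)}{n}f(0). \] In particular, if $\chi_k$ is an odd Dirichlet character modulo $k$, then \[ \sum_{n=1}^\infty\frac{\chi_k(n)}{n}f(an/k)=L_k(1,\chi_k)\,f(0),\qquad 0\le a\le 1. \]
   Context: For $\sigma>0$, $B_\sigma$ is the set of functions admitting a representation $f(x)=\int_{-\sigma}^{\sigma}e^{ixt}\varphi(t)\,dt$ with $\varphi$ square integrable on $[-\sigma,\sigma]$; equivalently (Paley–Wiener), the set of entire functions $f$ with $|f(z)|<Ce^{\sigma|z|}$ as $|z|\to\infty$ for some constant $C$ that are square integrable on the real axis. $L_k(s,\chi_k)=\sum_{n=1}^\infty\frac{\chi_k(n)}{n^s}$ (at $s=1$ the sum of the convergent series, i.e. the limit of its partial sums). *)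

(* Defs.v *)
From HB Require Import structures.
From mathcomp Require Import all_boot all_order all_algebra.
From mathcomp Require Import complex.
From mathcomp Require Import all_classical all_reals all_analysis.

Set Implicit Arguments.
Unset Strict Implicit.
Unset Printing Implicit Defensive.
Import Order.TTheory GRing.Theory Num.Theory numFieldNormedType.Exports.
Local Open Scope classical_set_scope.
Local Open Scope ring_scope.
Local Open Scope complex_scope.

Section complex_analysis.
Context {R : realType}.

Definition cexp (z : R[i]) : R[i] :=
  (expR (complex.Re z))%:C * (cos (complex.Im z) +i* sin (complex.Im z)).

(* The principal value of n ^ s; meaningful only for n > 0. *)
Definition natcpow (n : nat) (s : R[i]) : R[i] := cexp (s * (ln n%:R)%:C).

Definition cintegral (D : set R) (g : R -> R[i]) : R[i] :=
  (\int[lebesgue_measure]_(t in D) complex.Re (g t))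
  +i* (\int[lebesgue_measure]_(t in D) complex.Im (g t)).

Definition square_integrable (D : set R) (g : R -> R[i]) : Prop :=
  [/\ measurable_fun D (fun t => complex.Re (g t)),
      measurable_fun D (fun t => complex.Im (g t)) &
      lebesgue_measure.-integrable D
        (fun t => (complex.Re (g t) ^+ 2 + complex.Im (g t) ^+ 2)%:E)].

(* An entire f of this class is determined by its values on the real line, so
   only those are recorded. *)
Definition band_limited (sigma : R) : set (R -> R[i]) :=
  [set f | exists phi : R -> R[i],
     square_integrable `[- sigma, sigma] phi /\
     forall x : R, f x =
       cintegral `[- sigma, sigma] (fun t => cexp ('i * (x * t)%:C) * phi t)].

(* R[i]^o, as opposed to R[i], carries the topology of the modulus. *)
Definition partial_sums1 (u : nat -> R[i]) : nat -> R[i]^o :=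
  series (fun n => u n.+1 : R[i]^o).

Definition summable1 (u : nat -> R[i]) : Prop := cvgn (partial_sums1 u).

(* The sum of u n over n >= 1; meaningful when summable1 u. *)
Definition sum1 (u : nat -> R[i]) : R[i] := limn (partial_sums1 u).

Definition periodic_seq (k : nat) (chi : int -> R[i]) : Prop :=
  forall n : int, chi (n + k%:Z) = chi n.

Definition odd_seq (chi : int -> R[i]) : Prop :=
  forall n : int, chi (- n) = - chi n.

Definition dirichlet_character (k : nat) (chi : int -> R[i]) : Prop :=
  [/\ periodic_seq k chi,
      forall m n : int, chi (m * n) = chi m * chi n &
      forall n : int, (chi n != 0) = coprimez n k%:Z].

Definition dirichlet_term (chi : int -> R[i]) (s : R[i]) (n : nat) : R[i] :=
  chi n%:Z / natcpow n s.

Definition dirichlet_L (chi : int -> R[i]) (s : R[i]) : R[i] :=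
  sum1 (dirichlet_term chi s).

End complex_analysis.

(* Main.v *)
Require Import Defs.
From HB Require Import structures.
From mathcomp Require Import all_boot all_order all_algebra.
From mathcomp Require Import complex.
From mathcomp Require Import all_classical all_reals all_analysis.
From mathcomp Require Import measurable_realfun ring lra.

Set Implicit Arguments.
Unset Strict Implicit.
Unset Printing Implicit Defensive.
Import Order.TTheory GRing.Theory Num.Theory numFieldNormedType.Exports.
Local Open Scope classical_set_scope.
Local Open Scope ring_scope.
Local Open Scope complex_scope.

(** The function [f] is the cosine transform of some integrable [phi] on
[[-2pi, 2pi]]: evenness of [f] cancels the sine part of its Fourier
representation.  On the other side, an odd [k]-periodic sequence is a finite
combination of the sines [sin (n * al)] with [al = 2pi(j+1)/k], [j < k-1]
([odd_periodic_sine_sum]).  So everything reduces to one frequency [al], and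
there to the pointwise sums

    sum_(n >= 1) sin (n al) / n * cos (n th),    th = a t / k,

which are averages of the sawtooth series [sum_n sin (n x) / n] at
[x = al + th] and [x = al - th].

The decisive point is that this series equals [(pi - x) / 2], an affine
function, on the open interval [(0, 2pi)].  Averaging an affine function over
[al + th] and [al - th] gives its value at [al], whatever [th] is, provided
that both points stay in [(0, 2pi)].  Since [al] lies between [2pi/k] and
[2pi - 2pi/k], this holds as soon as [|th| < 2pi/k], that is, for all [t] in
the open band [|t| < 2pi] and all [0 <= a <= 1]: this is where the band limit
is used.  Hence the modulation by [cos (n th)] does not change the sum, for
almost every [t], and integrating against [phi] turns the sum into the same
constant times [f 0].

Exchanging the limit with the integral is dominated convergence: the partial
sums of the sawtooth series are bounded uniformly in [x] and in the number of
terms ([sine_sum_bounded]).  Convergence and boundedness both come from the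
quantitative estimate [sine_sum_near].  All the series of the theorem are
shown to converge to the same value [odd_value k chi], multiplied by [f 0]. *)

(** * The sawtooth series *)

Section SineSeries.
Context {R : realType}.
Implicit Types (x u t : R) (n m N : nat).

Definition sine_sum N x : R := \sum_(0 <= n < N) sin (n.+1%:R * x) / n.+1%:R.

Lemma sin_nat_pi n : sin (n%:R * pi : R) = 0.
Proof.
elim: n => [|n IH]; first by rewrite mul0r sin0.
by rewrite -[_.+1%:R]natr1 mulrDl mul1r sinDpi IH oppr0.
Qed.

Lemma sin_cos_nat_2pi m : sin (m%:R * (2 * pi) : R) = 0 /\ cos (m%:R * (2 * pi) : R) = 1.
Proof.
elim: m => [|m [IHs IHc]]; first by rewrite mul0r sin0 cos0.
have twopi : 2 * pi = pi *+ 2 :> R by rewrite mulr_natl.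
by rewrite -[_.+1%:R]natr1 mulrDl mul1r {2 4}twopi sinD2pi cosD2pi.
Qed.

Lemma sinD_nat_2pi m x : sin (x + m%:R * (2 * pi)) = sin x.
Proof. by have [s c] := sin_cos_nat_2pi m; rewrite sinD s c mulr0 addr0 mulr1. Qed.

Lemma cosD_nat_2pi m x : cos (x + m%:R * (2 * pi)) = cos x.
Proof. by have [s c] := sin_cos_nat_2pi m; rewrite cosD s c mulr0 subr0 mulr1. Qed.

(** The Dirichlet kernel: after multiplication by [2 sin (x / 2)] the sum of
cosines telescopes. *)
Lemma sin2_sum_cos N x :
  2 * sin (x / 2) * (\sum_(0 <= n < N) cos (n.+1%:R * x)) =
  sin ((N%:R + 2^-1) * x) - sin (x / 2).
Proof.
elim: N => [|N IH].
  by rewrite big_nil mulr0 add0r mulrC subrr.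
rewrite big_nat_recr //= mulrDr IH -[N.+1%:R]natr1.
have -> : (N%:R + 2^-1) * x = (N%:R + 1) * x - x / 2 by field.
have -> : (N%:R + 1 + 2^-1) * x = (N%:R + 1) * x + x / 2 by field.
rewrite sinB sinD; ring.
Qed.

Lemma is_derive_sine_sum N x :
  is_derive x 1 (sine_sum N) (\sum_(0 <= n < N) cos (n.+1%:R * x)).
Proof.
elim: N => [|N IH].
  rewrite big_nil (_ : sine_sum 0 = cst 0); first exact: is_derive_cst.
  by apply/funext => y; rewrite /sine_sum big_nil.
have -> : sine_sum N.+1 =
    sine_sum N + (N.+1%:R^-1 \*: (sin \o (N.+1%:R \*: id))).
  apply/funext => y; rewrite /sine_sum big_nat_recr //= fctE /=.
  by congr (_ + _); rewrite mulrC.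
rewrite big_nat_recr //=.
apply: is_deriveD.
apply: is_derive_eq.
rewrite /GRing.scale /=; field.
by rewrite addrC natr1 pnatr_eq0.
Qed.

Lemma sine_sum_pi N : sine_sum N pi = 0.
Proof.
rewrite /sine_sum big1_seq // => n _.
by rewrite sin_nat_pi mul0r.
Qed.

(** The error [sine_sum N u - (pi - u) / 2] has derivative
[sin (M u) / (2 sin (u / 2))] with [M = N + 1/2].  For [e = 0] the added
fraction is what one integration by parts extracts from that oscillating
derivative.  With [e], the derivative that remains is a multiple of
[cos (M u) + e], so that it has a
constant sign on [(0, pi)] when [e] is [1] or [-1]. *)
Definition corrected_sum N (e : R) u : R :=
  sine_sum N u - (pi - u) / 2
  + (cos ((N%:R + 2^-1) * u) + e) / (2 * (N%:R + 2^-1) * sin (u / 2)).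

Lemma is_derive_corrected_sum N e u : 0 < u < 2 * pi ->
  is_derive u 1 (corrected_sum N e)
    (- (cos (u / 2) * (cos ((N%:R + 2^-1) * u) + e))
      / (4 * (N%:R + 2^-1) * sin (u / 2) ^+ 2)).
Proof.
move=> /andP[u0 u2].
have s0 : 0 < sin (u / 2) by apply: sin_gt0_pi; lra.
set M := N%:R + 2^-1.
have M0 : 0 < M by rewrite /M ltr_wpDl ?ler0n// invr_gt0.
have sn0 : (sin \o (2^-1 \*: id)) u != 0.
  by rewrite /= /GRing.scale /= mulrC gt_eqF.
have -> : corrected_sum N e =
   sine_sum N + (2^-1 \*: id) + cst (- (pi / 2))
   + (((cos \o (M \*: id)) + cst e) *
      ((2 * M)^-1 \*: (fun x => ((sin \o (2^-1 \*: id)) x)^-1))).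
  apply/funext => y; rewrite /corrected_sum !fctE /= -/M /GRing.scale /=.
  rewrite [2^-1 * y]mulrC (invfM (2 * M)).
  by set S := (sin _)^-1; set I := (2 * M)^-1; set C := cos _; field.
have ds := is_derive_sine_sum N u.
have dirichlet : \sum_(0 <= n < N) cos (n.+1%:R * u) =
   (sin (M * u) - sin (u / 2)) / (2 * sin (u / 2)).
  rewrite -sin2_sum_cos mulrAC mulfV ?mul1r//.
  by rewrite mulf_neq0// gt_eqF.
apply: is_derive_eq.
have e1 : (sin \o 2^-1 \*: id) u = sin (u / 2) by rewrite /= /GRing.scale /= mulrC.
have e2 : (2^-1 \*: id) u = u / 2 by rewrite /= /GRing.scale /= mulrC.
have e3 : (cos \o (M \*: id) + cst e) u = cos (M * u) + e by [].
have e4 : ((2 * M)^-1 \*: (fun x => ((sin \o (2^-1 \*: id)) x)^-1)) u =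
          (2 * M)^-1 / sin (u / 2) by rewrite -e1.
have e5 : (M \*: id) u = M * u by [].
rewrite dirichlet e1 e2 e3 e4 e5 /GRing.scale /=.
by field; rewrite !gt_eqF.
Qed.
End SineSeries.

Section SineSeriesLimit.
Context {R : realType}.
Implicit Types (x u t : R) (n m N : nat).

(** The corrected sums for [e = 1] and [e = -1] are monotone in opposite
directions and explicit at [pi], where [sine_sum N] vanishes; comparing [x]
with [pi] therefore bounds the error on both sides. *)
Lemma sine_sum_near_half N x : 0 < x <= pi ->
  `|sine_sum N x - (pi - x) / 2| <= ((N%:R + 2^-1) * sin (x / 2))^-1.
Proof.
move=> /andP[x0 xpi].
have pi0 := pi_gt0 R.
have M0 : 0 < N%:R + 2^-1 :> R by rewrite ltr_wpDl ?ler0n// invr_gt0.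
have s0 u : 0 < u < 2 * pi -> 0 < sin (u / 2).
  by move=> /andP[u0 u2]; apply: sin_gt0_pi; lra.
have inI u : u \in `[x, pi] -> 0 < u < 2 * pi.
  by rewrite in_itv /= => /andP[xu up]; lra.
have inJ u : u \in `]x, pi[ -> 0 < u < 2 * pi.
  by rewrite in_itv /= => /andP[xu up]; lra.
have dG e u : 0 < u < 2 * pi -> derivable (corrected_sum N e) u 1.
  by move=> /(is_derive_corrected_sum N e)[].
have cG e : {within `[x, pi], continuous (corrected_sum N e)}.
  by apply: derivable_within_continuous => u /inI; exact: dG.
have dE e u : 0 < u < 2 * pi -> derive1 (corrected_sum N e) u =
    (- (cos (u / 2) * (cos ((N%:R + 2^-1) * u) + e))
      / (4 * (N%:R + 2^-1) * sin (u / 2) ^+ 2)).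
  by move=> /(is_derive_corrected_sum N e)[_ <-]; rewrite derive1E.
have K0 u : u \in `]x, pi[ ->
    0 <= cos (u / 2) / (4 * (N%:R + 2^-1) * sin (u / 2) ^+ 2).
  move=> uI; have /andP[u0 u2] := inJ _ uI.
  move: uI; rewrite in_itv /= => /andP[_ up].
  have c0 : 0 <= cos (u / 2) by apply: cos_ge0_pihalf; lra.
  by rewrite divr_ge0// mulr_ge0 ?sqr_ge0// mulr_ge0// ltW.
have xI : x \in `[x, pi] by rewrite in_itv /= lexx.
have pI : pi \in `[x, pi] by rewrite in_itv /= lexx xpi.
have dec : corrected_sum N 1 pi <= corrected_sum N 1 x.
  apply: (ler0_derive1_le_cc _ _ (cG 1)) => // u uI; first exact/dG/inJ.
  rewrite dE ?inJ// mulrAC mulNr oppr_le0 mulrAC [_ * _ / _]mulrAC.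
  by rewrite mulr_ge0 ?K0// -lerBlDr sub0r cos_geN1.
have inc : corrected_sum N (-1) x <= corrected_sum N (-1) pi.
  apply: (ger0_derive1_le_cc _ _ (cG (-1))) => // u uI; first exact/dG/inJ.
  rewrite dE ?inJ// -mulrN mulrAC.
  by rewrite mulr_ge0 ?K0// opprB subr_ge0 cos_le1.
move: dec inc; rewrite /corrected_sum sine_sum_pi subrr mul0r subr0 add0r.
rewrite sin_pihalf mulr1.
have -> : cos ((N%:R + 2^-1) * pi) = 0 :> R.
  by rewrite mulrDl cosD sin_nat_pi mul0r subr0 [2^-1 * pi]mulrC cos_pihalf mulr0.
set M := N%:R + 2^-1 in M0 *; rewrite !add0r.
have sx := s0 x (inI _ xI).
have -> : 2 * M * sin (x / 2) = 2 * (M * sin (x / 2)) by rewrite mulrA.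
have P0 : 0 < (M * sin (x / 2))^-1 by rewrite invr_gt0 mulr_gt0.
have Q0 : 0 < (2 * M)^-1 by rewrite invr_gt0 mulr_gt0.
rewrite mul1r mulN1r !(invfM 2 (M * _)) => dec inc.
set c := cos (M * x) in dec inc; set I := (M * _)^-1 in P0 dec inc *.
have c1 : c <= 1 := cos_le1 _.
have cN1 : -1 <= c := cos_geN1 _.
have cI1 : c * I <= I by rewrite ler_piMl// ltW.
have cI2 : - I <= c * I by rewrite -mulN1r ler_wpM2r// ltW.
rewrite ler_norml; lra.
Qed.

Lemma sine_sum_reflect N x : sine_sum N (2 * pi - x) = - sine_sum N x.
Proof.
rewrite /sine_sum -sumrN; apply: eq_bigr => n _.
by rewrite mulrBr addrC sinD_nat_2pi sinN mulNr.
Qed.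

Lemma sine_sum_near N x : 0 < x < 2 * pi ->
  `|sine_sum N x - (pi - x) / 2| <= ((N%:R + 2^-1) * sin (x / 2))^-1.
Proof.
move=> /andP[x0 x2]; have [xpi|xpi] := leP x pi.
  by apply: sine_sum_near_half; rewrite x0.
have /(sine_sum_near_half N) : 0 < 2 * pi - x <= pi by lra.
rewrite sine_sum_reflect -normrN.
have -> : - (- sine_sum N x - (pi - (2 * pi - x)) / 2) = sine_sum N x - (pi - x) / 2.
  by field.
suff -> : sin ((2 * pi - x) / 2) = sin (x / 2) by [].
have -> : (2 * pi - x) / 2 = - (x / 2) + pi by field.
by rewrite sinDpi sinN opprK.
Qed.

Lemma sin_nat_mul_le n t : `|sin (n%:R * t)| <= n%:R * `|sin t|.
Proof.
elim: n => [|n IH]; first by rewrite !mul0r sin0 normr0.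
rewrite -[n.+1%:R]natr1 !mulrDl !mul1r sinD.
apply: (le_trans (ler_normD _ _)); apply: lerD.
  by rewrite normrM (le_trans _ IH)// ler_piMr// cos_max.
by rewrite normrM ler_piMl// cos_max.
Qed.

(** Complements [sine_sum_near], which is useless when [N * x] is small. *)
Lemma sine_sum_le N x : `|sine_sum N x| <= N%:R * (2 * `|sin (x / 2)|).
Proof.
apply: (le_trans (ler_norm_sum _ _ _)).
rewrite mulr_natl -[N in _ *+ N]subn0 -sumr_const_nat.
apply: ler_sum => n _.
have n0 : 0 < n.+1%:R :> R by rewrite ltr0n.
rewrite normrM normfV (gtr0_norm n0) ler_pdivrMr// [leRHS]mulrC.
apply: (le_trans (sin_nat_mul_le _ _)); rewrite ler_pM2l//.
have := sin_nat_mul_le 2 (x / 2); by rewrite mulrC divfK.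
Qed.

Lemma sine_sum_bounded N x : 0 <= x <= 2 * pi -> `|sine_sum N x| <= pi / 2 + 2.
Proof.
move=> /andP[x0 x2]; have pi0 := pi_gt0 R.
have [/andP[]|/negP xE] := boolP (0 < x < 2 * pi); last first.
  have -> : sine_sum N x = 0; last by rewrite normr0; lra.
  have [->|->] : x = 0 \/ x = 2 * pi.
  - have [->|x0'] := eqVneq x 0; first by left.
    have [->|x2'] := eqVneq x (2 * pi); first by right.
    by case: xE; rewrite !lt_neqAle x0 x2 x2' eq_sym x0'.
  - by rewrite /sine_sum big1// => n _; rewrite mulr0 sin0 mul0r.
  - by rewrite /sine_sum big1// => n _; rewrite (sin_cos_nat_2pi _).1 mul0r.
move=> x0' x2'.
have M0 : 0 < N%:R + 2^-1 :> R by rewrite ltr_wpDl ?ler0n// invr_gt0.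
have s0 : 0 < sin (x / 2) by apply: sin_gt0_pi; lra.
(* Below this threshold the terms are small enough to be added up; above it,
   the error in [sine_sum_near] is at most 1. *)
have [small|large] := leP ((N%:R + 2^-1) * sin (x / 2)) 1.
  have := sine_sum_le N x; rewrite (gtr0_norm s0) => h.
  by apply: (le_trans h); lra.
have /(sine_sum_near N) h : 0 < x < 2 * pi by rewrite x0'.
have h1 : `|sine_sum N x - (pi - x) / 2| <= 1.
  by apply: (le_trans h); rewrite invf_le1 ?ltW// mulr_gt0.
move: h1; rewrite !ler_norml; lra.
Qed.

Lemma sine_sum_cvg x : 0 < x < 2 * pi ->
  sine_sum N x @[N --> \oo] --> (pi - x) / 2.
Proof.
move=> xI; have /andP[x0 x2] := xI.
have s0 : 0 < sin (x / 2) by apply: sin_gt0_pi; lra.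
apply/cvgrPdist_le => e e0; near=> N.
rewrite distrC; apply: (le_trans (sine_sum_near _ xI)).
have es0 : 0 < e * sin (x / 2) by rewrite mulr_gt0.
have large : (e * sin (x / 2))^-1 <= N%:R by near: N; exact: nbhs_infty_ger.
have N0 : 0 < N%:R :> R by rewrite (lt_le_trans _ large)// invr_gt0.
rewrite invfM -ler_pdivlMr ?invr_gt0// invrK.
rewrite -[leRHS]invrK lef_pV2 ?posrE ?invr_gt0 ?addr_gt0 ?invr_gt0//.
by rewrite (le_trans large)// lerDl invr_ge0.
Unshelve. all: by end_near. Qed.
End SineSeriesLimit.

(** * Modulation by a cosine *)

Section ModulatedSineSeries.
Context {R : realType}.
Implicit Types (a t : R) (N : nat).

Lemma modulated_sine_sumE N a t :
  \sum_(0 <= n < N) sin (n.+1%:R * a) / n.+1%:R * cos (n.+1%:R * t) =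
  (sine_sum N (a + t) + sine_sum N (a - t)) / 2.
Proof.
rewrite /sine_sum -big_split /= mulr_suml; apply: eq_bigr => n _.
by rewrite mulrBr mulrDr sinD sinB; field; rewrite addrC natr1 pnatr_eq0.
Qed.

Lemma modulated_sine_sum_bounded N a t :
  0 <= a - `|t| -> a + `|t| <= 2 * pi ->
  `|\sum_(0 <= n < N) sin (n.+1%:R * a) / n.+1%:R * cos (n.+1%:R * t)|
    <= pi / 2 + 2.
Proof.
move=> lo hi; rewrite modulated_sine_sumE.
have := ler_norm t; have := ler_norm (- t); rewrite normrN => t1 t2.
have /(sine_sum_bounded N) : 0 <= a + t <= 2 * pi by lra.
have /(sine_sum_bounded N) : 0 <= a - t <= 2 * pi by lra.
rewrite !ler_norml; lra.
Qed.

(** The limit does not depend on [t], because the limit of [sine_sum] is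
affine between the two points [a - t] and [a + t]. *)
Lemma modulated_sine_sum_cvg a t : 0 < a - `|t| -> a + `|t| < 2 * pi ->
  \sum_(0 <= n < N) sin (n.+1%:R * a) / n.+1%:R * cos (n.+1%:R * t)
    @[N --> \oo] --> (pi - a) / 2.
Proof.
move=> lo hi.
have := ler_norm t; have := ler_norm (- t); rewrite normrN => t1 t2.
under eq_fun do rewrite modulated_sine_sumE.
have -> : (pi - a) / 2 = ((pi - (a + t)) / 2 + (pi - (a - t)) / 2) / 2.
  by field.
by apply: cvgMl; apply: cvgD; apply: sine_sum_cvg; lra.
Qed.

End ModulatedSineSeries.

(** * Finite Fourier expansion of odd periodic sequences *)

Section OddPeriodic.
Context {R : realType}.

(** Orthogonality of the characters of the integers modulo [k], in real form:
if [k] does not divide [m], the Dirichlet kernel runs over whole periods and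
vanishes. *)
Lemma sum_cos_multiples (k m : nat) : (0 < k)%N ->
  \sum_(0 <= j < k) cos (j.+1%:R * (m%:R * (2 * pi / k%:R))) =
  (k%:R * (k %| m)%:R : R).
Proof.
move=> k0; have kR : 0 < k%:R :> R by rewrite ltr0n.
have pi0 := pi_gt0 R.
rewrite (divn_eq m k) /dvdn modnMDl modn_mod.
set q := (m %/ k)%N; set r := (m %% k)%N.
have rk : (r < k)%N by rewrite ltn_mod.
have red (j : nat) : j.+1%:R * ((q * k + r)%:R * (2 * pi / k%:R)) =
    j.+1%:R * (r%:R * (2 * pi / k%:R)) + (j.+1 * q)%:R * (2 * pi) :> R.
  by rewrite natrD !natrM; field; rewrite gt_eqF.
under eq_bigr do rewrite red cosD_nat_2pi.
have [->|r0] := posnP r.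
  under eq_bigr do rewrite mul0r mulr0 cos0.
  by rewrite sumr_const_nat subn0 /= mulr1.
rewrite mulr0; set x := r%:R * _.
have rR : 0 < (r%:R : R) < k%:R by rewrite ltr0n r0 ltr_nat.
have s0 : 0 < sin (x / 2).
  have -> : x / 2 = r%:R / k%:R * pi by rewrite /x; field; rewrite gt_eqF.
  apply: sin_gt0_pi; case/andP: rR => r0' rk'.
  by rewrite mulr_gt0 ?divr_gt0//= gtr_pMl// ltr_pdivrMr// mul1r.
have := sin2_sum_cos k x.
have -> : (k%:R + 2^-1) * x = x / 2 + r%:R * (2 * pi).
  by rewrite /x; field; rewrite gt_eqF.
rewrite sinD_nat_2pi subrr => /eqP.
by rewrite !mulf_eq0 pnatr_eq0 /= (gt_eqF s0) /= => /eqP.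
Qed.

Lemma periodic_seqM (k : nat) (chi : int -> R[i]) : periodic_seq k chi ->
  forall (z : int) (q : nat), chi (z + (q * k)%:Z) = chi z.
Proof.
move=> per z; elim=> [|q IH]; first by rewrite mul0n addr0.
by rewrite mulSn addnC PoszD addrA per.
Qed.

(** Only one residue [m] satisfies [m = - N] modulo [k]. *)
Lemma periodic_sum_pick (k N : nat) (chi : int -> R[i]) : (0 < k)%N ->
  periodic_seq k chi ->
  \sum_(0 <= m < k) chi m%:Z * (k %| m + N)%:R = chi (- N%:Z).
Proof.
move=> k0 per.
have kN : (N + k.-1 * N = N * k)%N by rewrite -mulSn prednK// mulnC.
(* The residue of [- N], written without subtraction. *)
set m0 := (k.-1 * N %% k)%N.
have m0k : (m0 < k)%N by rewrite ltn_mod.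
have pick (m : nat) : (m < k)%N -> (k %| m + N)%N = (m == m0).
  move=> mk; have -> : (k %| m + N)%N = (m + N == k.-1 * N + N %[mod k]).
    by rewrite [(k.-1 * N + N)%N]addnC kN modnMl.
  by rewrite eqn_modDr (modn_small mk).
rewrite big_mkord (bigD1 (Ordinal m0k)) //= pick// eqxx mulr1 big1 ?addr0.
  rewrite -[RHS](periodic_seqM per _ N) -kN PoszD addKr.
  by rewrite [in RHS](divn_eq (k.-1 * N) k) addnC PoszD periodic_seqM.
move=> i; rewrite -val_eqE /= => /negbTE ne.
by rewrite pick// ne mulr0.
Qed.

Definition sine_coef (k : nat) (chi : int -> R[i]) (j : nat) : R[i] :=
  k%:R^-1 * \sum_(0 <= m < k)
    chi m%:Z * (sin (m%:R * (j.+1%:R * (2 * pi / k%:R))))%:C.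

(** Orthogonality turns the double sum of products of sines into
[chi n - chi (- n)], up to a factor; oddness makes this [2 chi n].  The index
[j = k - 1], of frequency [2pi], contributes nothing and is left out, so that
all frequencies lie strictly between [0] and [2pi]. *)
Lemma odd_periodic_sine_sum (k : nat) (chi : int -> R[i]) : (0 < k)%N ->
  periodic_seq k chi -> odd_seq chi -> forall n : nat,
  chi n%:Z = \sum_(0 <= j < k.-1)
    sine_coef k chi j * (sin (n%:R * (j.+1%:R * (2 * pi / k%:R))))%:C.
Proof.
move=> k0 per odd n.
have kR : 0 < k%:R :> R by rewrite ltr0n.
have kC : k%:R != 0 :> R[i] by rewrite pnatr_eq0 -lt0n.
have extend : \sum_(0 <= j < k.-1)
    sine_coef k chi j * (sin (n%:R * (j.+1%:R * (2 * pi / k%:R))))%:C =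
  \sum_(0 <= j < k)
    sine_coef k chi j * (sin (n%:R * (j.+1%:R * (2 * pi / k%:R))))%:C.
  rewrite -[in RHS](prednK k0) big_nat_recr //= (prednK k0).
  have -> : k%:R * (2 * pi / k%:R) = 2 * pi :> R by field; rewrite gt_eqF.
  by rewrite (sin_cos_nat_2pi _).1 mulr0 addr0.
(* [k.-1 * n] stands for [- n] modulo [k]. *)
have product_to_sum (j m : nat) :
    2 * (sin (m%:R * (j.+1%:R * (2 * pi / k%:R)))
       * sin (n%:R * (j.+1%:R * (2 * pi / k%:R)))) =
    cos (j.+1%:R * ((m + k.-1 * n)%:R * (2 * pi / k%:R)))
    - cos (j.+1%:R * ((m + n)%:R * (2 * pi / k%:R))) :> R.
  set w := 2 * pi / k%:R.
  have -> : j.+1%:R * ((m + n)%:R * w) = m%:R * (j.+1%:R * w) + n%:R * (j.+1%:R * w).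
    by rewrite natrD; ring.
  have -> : j.+1%:R * ((m + k.-1 * n)%:R * w) =
      m%:R * (j.+1%:R * w) - n%:R * (j.+1%:R * w) + (j.+1 * n)%:R * (2 * pi).
    rewrite natrD !natrM -[k.-1%:R](addrK 1) natr1 prednK// /w.
    by field; rewrite gt_eqF.
  rewrite cosD_nat_2pi cosB cosD; ring.
rewrite extend; apply: (mulfI (_ : 2 * k%:R != 0)).
  by rewrite mulf_neq0// pnatr_eq0.
transitivity (\sum_(0 <= m < k) chi m%:Z *
    (k%:R * (k %| m + k.-1 * n)%:R - k%:R * (k %| m + n)%:R)).
  under eq_bigr do rewrite mulrBr [_ * (k%:R * _)]mulrCA [X in _ - X]mulrCA.
  rewrite sumrB -!mulr_sumr !periodic_sum_pick//.
  have -> : - (k.-1 * n)%:Z = n%:Z - (n * k)%:Z.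
    have <- : (n + k.-1 * n = n * k)%N by rewrite -mulSn prednK// mulnC.
    by rewrite PoszD opprD addrA subrr add0r.
  rewrite -(periodic_seqM per (_ - _) n) subrK odd; ring.
rewrite mulr_sumr.
under [RHS]eq_bigr => j _.
  rewrite /sine_coef -[2 * k%:R * _]mulrA -[_^-1 * _ * _]mulrA mulVKf// mulr_suml mulr_sumr.
  over.
rewrite exchange_big /=; apply: eq_bigr => m _.
have real_cos (p : nat) : k%:R * (k %| p)%:R =
    (\sum_(0 <= j < k) cos (j.+1%:R * (p%:R * (2 * pi / k%:R))))%:C :> R[i].
  by rewrite sum_cos_multiples// rmorphM !rmorph_nat.
rewrite !real_cos -rmorphB -sumrB.
rewrite rmorph_sum mulr_sumr; apply: eq_bigr => j _.
rewrite -product_to_sum !rmorphM rmorph_nat; ring.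
Qed.
End OddPeriodic.

(** * Sine series of values of a cosine transform *)

Section CosineTransform.
Context {R : realType}.
Notation mu := (@lebesgue_measure R).
Implicit Types (a c s t x : R) (p : R -> R) (N : nat).

Lemma integrable_dilate_mul (h : R -> R) s p x :
  continuous h -> (forall y, `|h y| <= 1) ->
  mu.-integrable `[- s, s] (EFin \o p) ->
  mu.-integrable `[- s, s] (EFin \o (fun t => h (x * t) * p t)).
Proof.
move=> ch h1 ip; pose g t := h (x * t).
rewrite (_ : _ \o _ = ((EFin \o g) \* (EFin \o p))%E).
  apply: integrableMr => //.
    apply: measurableT_comp; first exact: continuous_measurable_fun.
    exact: measurable_funM.
  exists 1; split=> // M M1 t _ /=; exact: le_trans (h1 _) (ltW M1).
by apply/funext => t /=; rewrite EFinM.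
Qed.

Lemma integrable_cos_mul s p x : mu.-integrable `[- s, s] (EFin \o p) ->
  mu.-integrable `[- s, s] (EFin \o (fun t => cos (x * t) * p t)).
Proof. exact: integrable_dilate_mul (@continuous_cos R) (@cos_max R). Qed.

Lemma integrable_sin_mul s p x : mu.-integrable `[- s, s] (EFin \o p) ->
  mu.-integrable `[- s, s] (EFin \o (fun t => sin (x * t) * p t)).
Proof. exact: integrable_dilate_mul (@continuous_sin R) (@sin_max R). Qed.

Lemma integral_sum_cos s p (w l : nat -> R) N :
  mu.-integrable `[- s, s] (EFin \o p) ->
  mu.-integrable `[- s, s]
    (EFin \o (fun t => (\sum_(0 <= n < N) w n * cos (l n * t)) * p t)) /\
  \sum_(0 <= n < N) w n * \int[mu]_(t in `[- s, s]) (cos (l n * t) * p t) =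
  \int[mu]_(t in `[- s, s])
    ((\sum_(0 <= n < N) w n * cos (l n * t)) * p t).
Proof.
move=> ip; elim: N => [|N [IHi IH]].
  rewrite big_nil; have z : (fun t => (\sum_(0 <= n < 0) w n * cos (l n * t)) * p t)
      = cst 0 by apply/funext => t; rewrite big_nil mul0r.
  rewrite z Rintegral_cst// mul0r; split=> //.
  exact: integrable0.
have iN := integrable_cos_mul (l N) ip.
have iwN : mu.-integrable `[- s, s] (EFin \o (fun t => w N * (cos (l N * t) * p t))).
  rewrite (_ : _ \o _ = (fun t => (w N)%:E * (cos (l N * t) * p t)%:E)%E).
    exact: integrableZl.
  by apply/funext => t /=; rewrite EFinM.
have split_last : (fun t => (\sum_(0 <= n < N.+1) w n * cos (l n * t)) * p t) =
    (fun t => (\sum_(0 <= n < N) w n * cos (l n * t)) * p t + w N * (cos (l N * t) * p t)).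
  by apply/funext => t; rewrite big_nat_recr //= mulrDl mulrA.
rewrite big_nat_recr //= IH split_last; split; last by rewrite RintegralD// RintegralZl.
move: IHi iwN; set g := fun t => _; set h := fun t => _ => ig ih.
by rewrite (_ : _ \o _ = ((EFin \o g) \+ (EFin \o h))%E)//; exact: integrableD.
Qed.

(** For [|t| < s] both [a + c t] and [a - c t] lie in [(0, 2pi)], so that the
kernel tends to [(pi - a) / 2] there.  At [t = s] or [t = - s] one of them may
hit an end of the interval, where the sawtooth jumps; this is harmless, as two
points have measure zero. *)
Lemma sine_series_cosine_transform a c s p :
  0 < a < 2 * pi -> 0 <= c -> c * s <= a -> a + c * s <= 2 * pi ->
  mu.-integrable `[- s, s] (EFin \o p) ->
  \sum_(0 <= n < N) sin (n.+1%:R * a) / n.+1%:R *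
     \int[mu]_(t in `[- s, s]) (cos (n.+1%:R * c * t) * p t) @[N --> \oo] -->
  (pi - a) / 2 * \int[mu]_(t in `[- s, s]) p t.
Proof.
move=> /andP[a0 a2] c0 lo hi ip.
pose w n : R := sin (n.+1%:R * a) / n.+1%:R.
pose l n : R := n.+1%:R * c.
under eq_fun do rewrite (integral_sum_cos w l _ ip).2.
have kernelE N t : \sum_(0 <= n < N) w n * cos (l n * t) =
    \sum_(0 <= n < N) sin (n.+1%:R * a) / n.+1%:R * cos (n.+1%:R * (c * t)).
  by apply: eq_bigr => n _; rewrite /w /l mulrA.
have inside t : `[- s, s]%classic t -> `|c * t| <= c * s.
  rewrite /= in_itv /= => ts; rewrite normrM (ger0_norm c0).
  by rewrite ler_wpM2l// ler_norml.
have iL : mu.-integrable `[- s, s] (EFin \o (fun t => (pi - a) / 2 * p t)).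
  rewrite (_ : _ \o _ = (fun t => ((pi - a) / 2)%:E * (p t)%:E)%E).
    exact: integrableZl.
  by apply/funext => t /=; rewrite EFinM.
rewrite -RintegralZl//.
have mD : measurable `[- s, s]%classic by exact: measurable_itv.
pose F N t := ((\sum_(0 <= n < N) w n * cos (l n * t)) * p t)%:E.
have mF N : measurable_fun `[- s, s] (F N).
  exact: (measurable_int mu (integral_sum_cos w l N ip).1).
have ml : measurable_fun `[- s, s] (fun t => ((pi - a) / 2 * p t)%:E).
  exact: (measurable_int mu iL).
have Fl : {ae mu, forall t, `[- s, s]%classic t ->
    F N t @[N --> \oo] --> ((pi - a) / 2 * p t)%:E}.
  exists [set - s; s]; split.
  + by apply: measurableU; exact: measurable_set1.
  + by apply: countable_lebesgue_measure0; exact/finite_set_countable/finite_set2.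
  + move=> t /= nP; apply: contrapT => /not_orP[ts1 ts2]; apply: nP => tD.
    have ct : `|c * t| <= c * s by apply: inside.
    have st : c = 0 \/ `|c * t| < c * s.
      have [->|c0'] := eqVneq c 0; [by left|right].
      rewrite normrM (ger0_norm c0) ltr_pM2l; last by rewrite lt_neqAle eq_sym c0'.
      move: tD; rewrite in_itv /= => /andP[t1 t2].
      rewrite ltr_norml !lt_neqAle t1 t2 !andbT.
      by apply/andP; split; apply/eqP => E; [apply: ts1|apply: ts2].
    apply: cvg_EFin; first by near=> N.
    rewrite /comp /=; apply: cvgMr_tmp.
    under eq_fun do rewrite kernelE.
    apply: modulated_sine_sum_cvg.
      by case: st => [->|st]; rewrite ?mul0r ?normr0; lra.
    by case: st => [->|st]; rewrite ?mul0r ?normr0; lra.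
have ig : mu.-integrable `[- s, s] (fun t => (pi / 2 + 2)%:E * `|(p t)%:E|)%E.
  by apply: integrableZl => //; exact: integrable_abse.
have dom : {ae mu, forall t N, `[- s, s]%classic t ->
    (`|F N t| <= (pi / 2 + 2)%:E * `|(p t)%:E|)%E}.
  apply: aeW => t N /= tD; rewrite -EFinM lee_fin normrM ler_wpM2r//.
  rewrite kernelE; have := inside t tD => ct.
  by apply: modulated_sine_sum_bounded; lra.
have [_ _ h] := @dominated_convergence _ _ _ mu _ mD _ _ _ mF ml Fl ig dom.
apply: fine_cvg; move: h; rewrite /Rintegral fineK//.
by apply: integrable_fin_num.
Unshelve. all: by end_near. Qed.
End CosineTransform.

(** * Even band-limited functions *)

Section BandLimited.
Context {R : realType}.
Notation mu := (@lebesgue_measure R).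
Implicit Types (s x t : R) (p q : R -> R).

(** On a bounded interval the integrable function [1 + |phi|^2] dominates
[phi]. *)
Lemma square_integrable_integrable s (phi : R -> R[i]) :
  square_integrable `[- s, s] phi ->
  mu.-integrable `[- s, s] (EFin \o (fun t => complex.Re (phi t))) /\
  mu.-integrable `[- s, s] (EFin \o (fun t => complex.Im (phi t))).
Proof.
move=> [mRe mIm sq].
have i1 : mu.-integrable `[- s, s] (EFin \o cst 1 : R -> \bar R).
  apply: measurable_bounded_integrable => //.
    by rewrite /= lebesgue_measure_itv /=; case: ifP => // _; rewrite -EFinD ltry.
  by exists 1; split=> // M M1 t _ /=; rewrite normr1 ltW.
have idom : mu.-integrable `[- s, s] (EFin \o
    (fun t => 1 + (complex.Re (phi t) ^+ 2 + complex.Im (phi t) ^+ 2))).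
  exact: (@integrableD _ _ _ mu _ (measurable_itv _) _ _ i1 sq).
split; (apply: le_integrable idom => //; first exact/measurable_EFinP) => t _ /=;
  rewrite lee_fin [leRHS]ger0_norm ?addr_ge0 ?sqr_ge0//;
  case: (phi t) => x y /=; rewrite ler_norml; nra.
Qed.

(** The sine parts of the integral change sign with [x]; comparing [f x] with
[f (- x)] shows that their contribution is zero. *)
Lemma even_band_limited_cosine s (f : R -> R[i]) : band_limited s f ->
  (forall x, f (- x) = f x) ->
  exists p q : R -> R,
  [/\ mu.-integrable `[- s, s] (EFin \o p),
      mu.-integrable `[- s, s] (EFin \o q) &
      forall x, f x = (\int[mu]_(t in `[- s, s]) (cos (x * t) * p t))
                   +i* (\int[mu]_(t in `[- s, s]) (cos (x * t) * q t))].
Proof.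
move=> [phi [/square_integrable_integrable [ip iq] fE]] even.
set p := fun t => _ in ip; set q := fun t => _ in iq.
exists p, q; split=> // x.
have E y : f y = (\int[mu]_(t in `[- s, s]) (cos (y * t) * p t)
                   - \int[mu]_(t in `[- s, s]) (sin (y * t) * q t))
              +i* (\int[mu]_(t in `[- s, s]) (cos (y * t) * q t)
                   + \int[mu]_(t in `[- s, s]) (sin (y * t) * p t)).
  rewrite fE /cintegral -RintegralB//; [|exact: integrable_cos_mul|exact: integrable_sin_mul].
  rewrite -RintegralD//; [|exact: integrable_cos_mul|exact: integrable_sin_mul].
  by congr (_ +i* _); apply: eq_Rintegral => t _;
    rewrite /cexp /p /q; case: (phi t) => u v /=;
    rewrite !(mul0r, mulr0, mul1r, subr0, sub0r, addr0, add0r, oppr0, expR0) //; ring.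
have cosNx r : \int[mu]_(t in `[- s, s]) (cos (- x * t) * r t) =
   \int[mu]_(t in `[- s, s]) (cos (x * t) * r t).
  by apply: eq_Rintegral => t _; rewrite mulNr cosN.
have sinNx r : mu.-integrable `[- s, s] (EFin \o r) ->
   \int[mu]_(t in `[- s, s]) (sin (- x * t) * r t) =
   - \int[mu]_(t in `[- s, s]) (sin (x * t) * r t).
  move=> ir; rewrite -[RHS]mulN1r -RintegralZl//; last exact: integrable_sin_mul.
  by apply: eq_Rintegral => t _; rewrite mulNr sinN mulN1r mulNr.
have := even x; rewrite !E !cosNx !sinNx// => -[e1 e2].
by congr (_ +i* _); lra.
Qed.

End BandLimited.

(** * Convergence of the series *)

Section ComplexSeries.
Context {R : realType}.

Lemma cvg_real_complex (u : nat -> R) (l : R) : u n @[n --> \oo] --> l ->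
  ((u n)%:C : R[i]^o) @[n --> \oo] --> (l%:C : R[i]^o).
Proof.
move=> /cvgrPdist_le ul; apply/cvgrPdist_le => e; rewrite lt_def => /andP[].
case: e => a b; rewrite eq_complex lecE /= => ab /andP[/eqP b0 a0].
subst b; move: ab; rewrite eqxx andbT => ab.
have a0' : 0 < a by rewrite lt_def ab.
near=> n; rewrite -rmorphB normc_def /= expr0n addr0 sqrtr_sqr lecE /= eqxx /=.
by near: n; exact: ul.
Unshelve. all: by end_near. Qed.

Lemma cvg_complex_sum (I : Type) (r : seq I) (u : I -> nat -> R[i]^o) (l : I -> R[i]^o) :
  (forall j, u j n @[n --> \oo] --> l j) ->
  \sum_(j <- r) u j n @[n --> \oo] --> \sum_(j <- r) l j.
Proof.
move=> ul; apply: cvg_big => //; exact: add_continuous.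
Qed.

End ComplexSeries.

Section OddSeries.
Context {R : realType}.
Implicit Types (k : nat) (chi : int -> R[i]).

Definition frequency k (j : nat) : R := j.+1%:R * (2 * pi / k%:R).

(** The sum of [chi n / n] over [n >= 1], computed from the finite Fourier
expansion of [chi] and the values [(pi - x) / 2] of the sawtooth series. *)
Definition odd_value k chi : R[i] :=
  \sum_(0 <= j < k.-1) sine_coef k chi j * ((pi - frequency k j) / 2)%:C.

(** Reduces a series with coefficients [chi n] to one frequency at a time. *)
Lemma odd_periodic_series_cvg k chi (g : nat -> R[i]) (g0 : R[i]) :
  (0 < k)%N -> periodic_seq k chi -> odd_seq chi ->
  (forall j, (j < k.-1)%N ->
    (\sum_(0 <= n < N) (sin (n.+1%:R * frequency k j) / n.+1%:R)%:C * g n.+1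
      : R[i]^o) @[N --> \oo] --> (((pi - frequency k j) / 2)%:C * g0 : R[i]^o)) ->
  partial_sums1 (fun n => chi n%:Z / n%:R * g n) @ \oo -->
    (odd_value k chi * g0 : R[i]^o).
Proof.
move=> k0 per odd gl.
have -> : partial_sums1 (fun n => chi n%:Z / n%:R * g n) =
    fun N => \sum_(0 <= j < k.-1) (sine_coef k chi j *:
      (\sum_(0 <= n < N) (sin (n.+1%:R * frequency k j) / n.+1%:R)%:C * g n.+1
       : R[i]^o)).
  apply/funext => N; rewrite /partial_sums1 seriesEnat /=.
  under [RHS]eq_bigr do rewrite scaler_sumr.
  rewrite exchange_big /=; apply: eq_bigr => n _.
  rewrite (odd_periodic_sine_sum k0 per odd) -/(frequency _ _) !mulr_suml.
  apply: eq_bigr => j _; rewrite /GRing.scale /= rmorphM fmorphV rmorph_nat.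
  by rewrite !mulrA.
rewrite /odd_value mulr_suml.
rewrite !big_mkord.
under eq_fun do rewrite big_mkord.
apply: cvg_complex_sum => j.
rewrite -mulrA; exact: cvgZl_tmp (gl j (ltn_ord j)).
Qed.

(** The distance [2pi / k] to both [0] and [2pi] is the room for modulation that
a function of band [2pi], sampled with step at most [1 / k], requires. *)
Lemma frequency_bounds k j : (j < k.-1)%N ->
  [/\ 0 < frequency k j < 2 * pi, 2 * pi / k%:R <= frequency k j &
      frequency k j + 2 * pi / k%:R <= 2 * pi].
Proof.
move=> jk; have k0 : (0 < k)%N by case: k jk.
have kR : 0 < k%:R :> R by rewrite ltr0n.
have w0 : 0 < 2 * pi / k%:R :> R by rewrite divr_gt0// mulr_gt0// pi_gt0.
have wE : k%:R * (2 * pi / k%:R) = 2 * pi :> R by field; rewrite gt_eqF.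
have j1 : 1 <= j.+1%:R :> R by rewrite ler1n.
have j2 : j.+1%:R + 1 <= k%:R :> R by rewrite natr1 ler_nat; case: k jk {k0 kR w0 wE}.
have lo : 2 * pi / k%:R <= frequency k j by rewrite ler_peMl// ltW.
have hi : frequency k j + 2 * pi / k%:R <= 2 * pi.
  by rewrite -[leRHS]wE -[X in _ + X]mul1r -mulrDl ler_pM2r.
split=> //; apply/andP; split; lra.
Qed.

Lemma odd_periodic_series_cst k chi (v : R[i]) :
  (0 < k)%N -> periodic_seq k chi -> odd_seq chi ->
  partial_sums1 (fun n => chi n%:Z / n%:R * v) @ \oo -->
    (odd_value k chi * v : R[i]^o).
Proof.
move=> k0 per odd; apply: odd_periodic_series_cvg => // j /frequency_bounds[fI _ _].
rewrite [_ * v]mulrC.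
have -> : (fun N => \sum_(0 <= n < N)
      (sin (n.+1%:R * frequency k j) / n.+1%:R)%:C * v : R[i]^o) =
    fun N => v *: ((sine_sum N (frequency k j))%:C : R[i]^o).
  by apply/funext => N; rewrite -mulr_suml -rmorph_sum mulrC.
by apply: cvgZl_tmp; apply: cvg_real_complex; exact: sine_sum_cvg.
Qed.

Lemma odd_periodic_series_band_limited k chi (f : R -> R[i]) (a : R) :
  (0 < k)%N -> periodic_seq k chi -> odd_seq chi ->
  band_limited (2 * pi) f -> (forall x, f (- x) = f x) -> 0 <= a <= 1 ->
  partial_sums1 (fun n => chi n%:Z / n%:R * f (a * n%:R / k%:R)) @ \oo -->
    (odd_value k chi * f 0 : R[i]^o).
Proof.
move=> k0 per odd fb even /andP[a0 a1].
have [p [q [ip iq fE]]] := even_band_limited_cosine fb even.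
have kR : 0 < k%:R :> R by rewrite ltr0n.
have pi0 := pi_gt0 R.
apply: odd_periodic_series_cvg => // j /frequency_bounds[fI lo hi].
set al := frequency k j in fI lo hi *.
have c0 : 0 <= a / k%:R by rewrite divr_ge0// ltW.
have cs : a / k%:R * (2 * pi) <= 2 * pi / k%:R.
  by rewrite mulrAC -mulrA ler_piMl// divr_ge0// mulr_ge0// ltW.
have lo' : a / k%:R * (2 * pi) <= al by exact: le_trans lo.
have hi' : al + a / k%:R * (2 * pi) <= 2 * pi by lra.
have cvgp := sine_series_cosine_transform fI c0 lo' hi' ip.
have cvgq := sine_series_cosine_transform fI c0 lo' hi' iq.
pose A r N : R := \sum_(0 <= n < N) sin (n.+1%:R * al) / n.+1%:R *
  \int[lebesgue_measure]_(t in `[- (2 * pi), 2 * pi])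
    (cos (n.+1%:R * (a / k%:R) * t) * r t).
have cplx (x y : R) : x +i* y = x%:C + 'i * y%:C.
  exact: (complexE (x +i* y)).
have mulC (r x y : R) : r%:C * (x%:C + 'i * y%:C) = (r * x)%:C + 'i * (r * y)%:C.
  by rewrite mulrDr mulrCA -!rmorphM.
rewrite (_ : (fun N => _) =
    (fun N => ((A p N)%:C : R[i]^o) + 'i *: ((A q N)%:C : R[i]^o))); last first.
  apply/funext => N; rewrite /A !rmorph_sum scaler_sumr -big_split /=.
  apply: eq_bigr => n _; rewrite fE cplx.
  have -> : a * n.+1%:R / k%:R = n.+1%:R * (a / k%:R) by rewrite mulrA [a * _]mulrC.
  by rewrite mulC.
have cos0E r : \int[lebesgue_measure]_(t in `[- (2 * pi), 2 * pi]) (cos (0 * t) * r t)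
    = \int[lebesgue_measure]_(t in `[- (2 * pi), 2 * pi]) r t :> R.
  by apply: eq_Rintegral => t _; rewrite mul0r cos0 mul1r.
rewrite fE !cos0E cplx mulC.
apply: cvgD; first exact: cvg_real_complex.
by apply: cvgZl_tmp; exact: cvg_real_complex.
Qed.

Lemma sum1_cvg (u : nat -> R[i]) (l : R[i]) :
  partial_sums1 u @ \oo --> (l : R[i]^o) -> summable1 u /\ sum1 u = l.
Proof.
move=> ul; split; first by apply/cvg_ex; exists l.
exact: (cvg_lim (@norm_hausdorff _ _) ul).
Qed.

Lemma natcpow1 (n : nat) : (0 < n)%N -> natcpow n (1 : R[i]) = n%:R.
Proof.
move=> n0; rewrite /natcpow mul1r /cexp /= lnK ?posrE ?ltr0n//.
by rewrite cos0 sin0 mulr1 rmorph_nat.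
Qed.

Lemma partial_sums1_dirichlet_term1 chi :
  partial_sums1 (dirichlet_term chi 1) =
  partial_sums1 (fun n => chi n%:Z / n%:R * 1).
Proof.
rewrite /partial_sums1; congr series; apply/funext => n.
by rewrite /dirichlet_term natcpow1// mulr1.
Qed.

End OddSeries.

Theorem proposition2 (R : realType) (k : nat) (hk : (0 < k)%N)
    (f : R -> R[i]) (hf : band_limited (2 * pi) f)
    (f_even : forall x : R, f (- x) = f x) :
  (forall chi : int -> R[i], periodic_seq k chi -> odd_seq chi ->
     [/\ summable1 (fun n => chi n%:Z / n%:R * f (n%:R / k%:R)),
         summable1 (fun n => chi n%:Z / n%:R * f 0) &
         sum1 (fun n => chi n%:Z / n%:R * f (n%:R / k%:R))
         = sum1 (fun n => chi n%:Z / n%:R * f 0)])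
  /\
  (forall chi : int -> R[i], dirichlet_character k chi -> odd_seq chi ->
     forall a : R, 0 <= a <= 1 ->
     [/\ summable1 (fun n => chi n%:Z / n%:R * f (a * n%:R / k%:R)),
         summable1 (dirichlet_term chi 1) &
         sum1 (fun n => chi n%:Z / n%:R * f (a * n%:R / k%:R))
         = dirichlet_L chi 1 * f 0]).
Proof.
split=> [chi per odd|chi [per _ _] odd a a01].
  have i01 : 0 <= (1 : R) <= 1 by rewrite ler01 lexx.
  have := odd_periodic_series_band_limited hk per odd hf f_even i01.
  under eq_fun do rewrite mul1r.
  move=> /sum1_cvg[s1 ->].
  have /sum1_cvg[s2 ->] := @odd_periodic_series_cst _ _ _ (f 0) hk per odd.
  by split; [exact: s1|exact: s2|].
have /sum1_cvg[s1 ->] := odd_periodic_series_band_limited hk per odd hf f_even a01.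
have := @odd_periodic_series_cst _ _ _ 1 hk per odd.
rewrite -partial_sums1_dirichlet_term1 mulr1 => /sum1_cvg[s2 LE].
rewrite /dirichlet_L LE.
by split; [exact: s1|exact: s2|].
Qed.
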